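(* Let $\mathbb{E}$ be a finitely complete category and $Y$ an object of $\mathbb{E}$. If $\mathbb{E}$ is $\mathbb P$-decomposable (resp. stably $\mathbb P$-decomposable), then so are the slice category $\mathbb{E}/Y$ and the coslice category $Y/\mathbb{E}$. Accordingly, so is the fibre $\mathrm{Pt}_Y\mathbb{E}=1_Y/(\mathbb{E}/Y)$.
   Context: Extremal decompositions. Let $\Theta$ be a class of morphisms in a category $\mathbb{D}$ and $v:U\rightarrowtail T$ a monomorphism. A decomposition $v=w.u$ with $u:U\to X$ in $\Theta$ is $\Theta$-extremal when for any other decomposition $v=w'.u'$ with $u':U\to X'$ in $\Theta$, there is a unique $t:X'\to X$ with $w.t=w'$ and $t.u'=u$. $\mathbb{D}$ has $\Theta$-extremal decompositions of monomorphisms when any monomorphism has one; it has them stably when moreover they are stable under pullback along maps in $\Theta$. Points. For a finitely complete category $\mathbb C$, $\mathrm{Pt}\,\mathbb{C}$ is the category whose objects are the split epimorphisms $(f,s):X\rightleftarrows Y$, $f.s=1_Y$, with chosen splitting, and whose maps $(y,x):(f',s')\to(f,s)$ are pairs with $f.x=y.f'$ and $x.s'=s.y$. $\mathbb P_{\mathbb C}:\mathrm{Pt}\,\mathbb C\to\mathbb C$ sends $(f,s)$ to the codomain $Y$ of $f$; its fibre over $Y$ (split epimorphisms over $Y$, maps with $y=1_Y$) is $\mathrm{Pt}_Y\mathbb C$; $(y,x)$ is $\mathbb P_{\mathbb C}$-cartesian iff $f.x=y.f'$ is a pullback square. $\mathbb{C}$ is (stably) $\mathbb P$-decomposable when $\mathrm{Pt}\,\mathbb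 C$ has (stably) $\Theta$-extremal decompositions of monomorphisms for $\Theta$ the class of $\mathbb P_{\mathbb C}$-cartesian maps. *)

(* Defs.v *)
From Stdlib Require Import List ProofIrrelevance.

Set Implicit Arguments.
Unset Strict Implicit.

Declare Scope cat_scope.
Delimit Scope cat_scope with cat.
Open Scope cat_scope.

Record Category := {
  Ob :> Type;
  Hom : Ob -> Ob -> Type;
  id : forall x, Hom x x;
  comp : forall x y z, Hom y z -> Hom x y -> Hom x z;
  comp_id_l : forall x y (f : Hom x y), comp (id y) f = f;
  comp_id_r : forall x y (f : Hom x y), comp f (id x) = f;
  comp_assoc : forall x y z t (h : Hom z t) (g : Hom y z) (f : Hom x y),
    comp h (comp g f) = comp (comp h g) f
}.

Arguments Hom {c} _ _.
Arguments id {c} x.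
Arguments comp {c x y z} _ _.

Notation "g ∘ f" := (comp g f) (at level 40, left associativity) : cat_scope.

Record Functor (C D : Category) := {
  fobj :> C -> D;
  fmap : forall a b : C, Hom a b -> Hom (fobj a) (fobj b);
  fmap_id : forall a : C, fmap (id a) = id (fobj a);
  fmap_comp : forall (a b c : C) (g : Hom b c) (f : Hom a b),
    fmap (g ∘ f) = fmap g ∘ fmap f
}.

Arguments fmap {C D} _ [a b] _.

Definition bijective (A B : Type) (f : A -> B) : Prop :=
  forall b, exists! a, f a = b.

Definition is_isomorphism_of_categories (C D : Category) (F : Functor C D) : Prop :=
  bijective (fobj F) /\ forall a b : C, bijective (@fmap C D F a b).

Definition mono (C : Category) (a b : C) (m : Hom a b) : Prop :=
  forall (z : C) (g h : Hom z a), m ∘ g = m ∘ h -> g = h.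

Definition finite_category (J : Category) : Prop :=
  (exists l : list J, forall j, In j l) /\
  (forall i j : J, exists l : list (Hom i j), forall h, In h l).

Definition is_cone (J C : Category) (D : Functor J C) (L : C)
    (p : forall j, Hom L (D j)) : Prop :=
  forall (i j : J) (h : Hom i j), fmap D h ∘ p i = p j.

Definition is_limit (J C : Category) (D : Functor J C) (L : C)
    (p : forall j, Hom L (D j)) : Prop :=
  is_cone p /\
  forall (Z : C) (q : forall j, Hom Z (D j)), is_cone q ->
    exists! t : Hom Z L, forall j, p j ∘ t = q j.

Definition finitely_complete (C : Category) : Prop :=
  forall J : Category, finite_category J -> forall D : Functor J C,
    exists (L : C) (p : forall j, Hom L (D j)), is_limit p.

(** The square
<<
      P --p--> A
      |        |
      q        f
      v        v
      B --g--> Z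
>> *)
Definition is_pullback (C : Category) (P A B Z : C)
    (f : Hom A Z) (g : Hom B Z) (p : Hom P A) (q : Hom P B) : Prop :=
  f ∘ p = g ∘ q /\
  forall (W : C) (a : Hom W A) (b : Hom W B), f ∘ a = g ∘ b ->
    exists! t : Hom W P, p ∘ t = a /\ q ∘ t = b.

Definition MorClass (C : Category) := forall a b : C, Hom a b -> Prop.

(* [w] is not required to be a monomorphism. *)
Definition extremal_decomposition (D : Category) (Θ : MorClass D)
    (U X T : D) (v : Hom U T) (w : Hom X T) (u : Hom U X) : Prop :=
  Θ U X u /\ v = w ∘ u /\
  forall (X' : D) (u' : Hom U X') (w' : Hom X' T),
    Θ U X' u' -> v = w' ∘ u' ->
    exists! t : Hom X' X, w ∘ t = w' /\ t ∘ u' = u.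

Definition has_extremal_decompositions (D : Category) (Θ : MorClass D) : Prop :=
  forall (U T : D) (v : Hom U T), mono v ->
    exists (X : D) (w : Hom X T) (u : Hom U X),
      extremal_decomposition Θ v w u.

(* [v'] and [w'] are the pullbacks of [v] and [w] along [θ], and [u'] is the
   comparison map induced by [u]. *)
Definition extremal_decompositions_stable (D : Category) (Θ : MorClass D) : Prop :=
  forall (U X T : D) (v : Hom U T) (w : Hom X T) (u : Hom U X),
    mono v -> extremal_decomposition Θ v w u ->
  forall (U' X' T' : D) (θ : Hom T' T) (θU : Hom U' U) (θX : Hom X' X)
    (v' : Hom U' T') (w' : Hom X' T') (u' : Hom U' X'),
    Θ T' T θ ->
    is_pullback v θ θU v' ->
    is_pullback w θ θX w' ->
    θX ∘ u' = u ∘ θU -> w' ∘ u' = v' ->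
    extremal_decomposition Θ v' w' u'.

Definition stably_has_extremal_decompositions (D : Category) (Θ : MorClass D) : Prop :=
  has_extremal_decompositions Θ /\ extremal_decompositions_stable Θ.

Record SliceOb (E : Category) (Y : E) := {
  slice_dom : E;
  slice_arr : Hom slice_dom Y
}.

Record SliceHom (E : Category) (Y : E) (A B : SliceOb Y) := {
  slice_map : Hom (slice_dom A) (slice_dom B);
  slice_map_arr : slice_arr B ∘ slice_map = slice_arr A
}.

Lemma slice_hom_ext (E : Category) (Y : E) (A B : SliceOb Y) (g h : SliceHom A B) :
  slice_map g = slice_map h -> g = h.
Proof.
destruct g as [g pg], h as [h ph]; simpl; intros <-.
f_equal; apply proof_irrelevance.
Qed.

Definition slice_id (E : Category) (Y : E) (A : SliceOb Y) : SliceHom A A :=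
  {| slice_map := id (slice_dom A); slice_map_arr := comp_id_r (slice_arr A) |}.

Definition slice_comp (E : Category) (Y : E) (A B C : SliceOb Y)
    (g : SliceHom B C) (f : SliceHom A B) : SliceHom A C.
Proof.
refine {| slice_map := slice_map g ∘ slice_map f |}.
abstract (rewrite comp_assoc, slice_map_arr; apply slice_map_arr).
Defined.

Definition Slice (E : Category) (Y : E) : Category.
Proof.
refine {| Ob := SliceOb Y; Hom := @SliceHom E Y;
          id := @slice_id E Y; comp := @slice_comp E Y |};
abstract (intros; apply slice_hom_ext; simpl;
          auto using comp_id_l, comp_id_r, comp_assoc).
Defined.

Record CosliceOb (E : Category) (Y : E) := {
  coslice_cod : E;
  coslice_arr : Hom Y coslice_cod
}.

Record CosliceHom (E : Category) (Y : E) (A B : CosliceOb Y) := {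
  coslice_map : Hom (coslice_cod A) (coslice_cod B);
  coslice_map_arr : coslice_map ∘ coslice_arr A = coslice_arr B
}.

Lemma coslice_hom_ext (E : Category) (Y : E) (A B : CosliceOb Y)
    (g h : CosliceHom A B) :
  coslice_map g = coslice_map h -> g = h.
Proof.
destruct g as [g pg], h as [h ph]; simpl; intros <-.
f_equal; apply proof_irrelevance.
Qed.

Definition coslice_id (E : Category) (Y : E) (A : CosliceOb Y) : CosliceHom A A :=
  {| coslice_map := id (coslice_cod A);
     coslice_map_arr := comp_id_l (coslice_arr A) |}.

Definition coslice_comp (E : Category) (Y : E) (A B C : CosliceOb Y)
    (g : CosliceHom B C) (f : CosliceHom A B) : CosliceHom A C.
Proof.
refine {| coslice_map := coslice_map g ∘ coslice_map f |}.
abstract (rewrite <- comp_assoc, coslice_map_arr; apply coslice_map_arr).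
Defined.

Definition Coslice (E : Category) (Y : E) : Category.
Proof.
refine {| Ob := CosliceOb Y; Hom := @CosliceHom E Y;
          id := @coslice_id E Y; comp := @coslice_comp E Y |};
abstract (intros; apply coslice_hom_ext; simpl;
          auto using comp_id_l, comp_id_r, comp_assoc).
Defined.

Record PointOver (C : Category) (Y : C) := {
  pt_top : C;
  pt_epi : Hom pt_top Y;
  pt_sec : Hom Y pt_top;
  pt_split : pt_epi ∘ pt_sec = id Y
}.

Record PtOb (C : Category) := {
  pt_base : C;
  pt_over :> PointOver pt_base
}.

Record PtHom (C : Category) (A B : PtOb C) := {
  pt_map_base : Hom (pt_base A) (pt_base B);
  pt_map_top : Hom (pt_top A) (pt_top B);
  pt_map_epi : pt_epi B ∘ pt_map_top = pt_map_base ∘ pt_epi A;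
  pt_map_sec : pt_map_top ∘ pt_sec A = pt_sec B ∘ pt_map_base
}.

Lemma pt_hom_ext (C : Category) (A B : PtOb C) (g h : PtHom A B) :
  pt_map_base g = pt_map_base h -> pt_map_top g = pt_map_top h -> g = h.
Proof.
destruct g as [g1 g2 p1 p2], h as [h1 h2 q1 q2]; simpl; intros <- <-.
f_equal; apply proof_irrelevance.
Qed.

Definition pt_id (C : Category) (A : PtOb C) : PtHom A A.
Proof.
refine {| pt_map_base := id (pt_base A); pt_map_top := id (pt_top A) |};
abstract (now rewrite comp_id_l, comp_id_r).
Defined.

Definition pt_comp (C : Category) (A B D : PtOb C)
    (g : PtHom B D) (f : PtHom A B) : PtHom A D.
Proof.
refine {| pt_map_base := pt_map_base g ∘ pt_map_base f;
          pt_map_top := pt_map_top g ∘ pt_map_top f |}.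
- abstract (rewrite comp_assoc, pt_map_epi, <- !comp_assoc, pt_map_epi;
            reflexivity).
- abstract (rewrite <- comp_assoc, pt_map_sec, !comp_assoc, pt_map_sec;
            reflexivity).
Defined.

Definition Pt (C : Category) : Category.
Proof.
refine {| Ob := PtOb C; Hom := @PtHom C; id := @pt_id C; comp := @pt_comp C |};
abstract (intros; apply pt_hom_ext; simpl;
          auto using comp_id_l, comp_id_r, comp_assoc).
Defined.

Definition Pt_functor (C : Category) : Functor (Pt C) C.
Proof.
refine {| fobj := (fun A : Pt C => pt_base A);
          fmap := (fun (A B : Pt C) (h : Hom A B) => pt_map_base h) |};
abstract reflexivity.
Defined.

Definition cartesian (D C : Category) (P : Functor D C) : MorClass D :=
  fun (A B : D) (h : Hom A B) =>
    forall (Z : D) (k : Hom Z B) (g : Hom (P Z) (P A)),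
      fmap P h ∘ g = fmap P k ->
      exists! t : Hom Z A, h ∘ t = k /\ fmap P t = g.

Definition cospan_hom (i j : option bool) : Type :=
  match i, j with
  | _, None => unit
  | Some true, Some true | Some false, Some false => unit
  | _, _ => Empty_set
  end.

Definition cospan : Category.
Proof.
unshelve refine {| Ob := option bool; Hom := cospan_hom |}.
- intros [[]|]; exact tt.
- intros [[]|] [[]|] [[]|] [] []; exact tt.
- abstract (intros [[]|] [[]|] []; reflexivity).
- abstract (intros [[]|] [[]|] []; reflexivity).
- abstract (intros [[]|] [[]|] [[]|] [[]|] [] [] []; reflexivity).
Defined.

Lemma finite_cospan : finite_category cospan.
Proof.
split.
- exists (None :: Some true :: Some false :: nil).
  intros [[]|]; simpl; auto.
- intros [[]|] [[]|]; simpl;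
    first [solve [exists nil; intros []] | exists (tt :: nil); intros []; simpl; auto].
Qed.

Definition cospan_functor (C : Category) (A B Z : C) (f : Hom A Z) (g : Hom B Z) :
  Functor cospan C.
Proof.
unshelve refine {|
  fobj := (fun i : cospan =>
    match i with Some true => A | Some false => B | None => Z end) |}.
- intros [[]|] [[]|] h;
    first [exact (id _) | exact f | exact g | destruct h].
- abstract (intros [[]|]; reflexivity).
- abstract (intros [[]|] [[]|] [[]|] [] []; simpl;
            auto using eq_sym, comp_id_l, comp_id_r).
Defined.

Lemma finitely_complete_pullback (C : Category) (A B Z : C)
    (f : Hom A Z) (g : Hom B Z) :
  finitely_complete C ->
  exists (P : C) (p : Hom P A) (q : Hom P B), is_pullback f g p q.
Proof.
intros HC.
destruct (HC _ finite_cospan (cospan_functor f g)) as (L & p & cone & univ).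
assert (ef : f ∘ p (Some true) = p None) by exact (cone (Some true) None tt).
assert (eg : g ∘ p (Some false) = p None) by exact (cone (Some false) None tt).
exists L, (p (Some true)), (p (Some false)); split.
{ now rewrite ef, eg. }
intros W a b e.
destruct (univ W (fun i : option bool =>
  match i return Hom W (cospan_functor f g i) with
  | Some true => a | Some false => b | None => f ∘ a end)) as (t & ht & tu).
{ intros [[]|] [[]|] []; simpl; auto using eq_sym, comp_id_l. }
exists t; split.
{ split; [exact (ht (Some true)) | exact (ht (Some false))]. }
intros t' [e1 e2]; apply tu; intros [[]|]; simpl; auto.
rewrite <- ef, <- comp_assoc; now f_equal.
Qed.

Lemma cartesian_iff_pullback (C : Category) (A B : Pt C) (h : Hom A B) :
  finitely_complete C ->
  cartesian (Pt_functor C) h <->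
  is_pullback (pt_epi B) (pt_map_base h) (pt_map_top h) (pt_epi A).
Proof.
intros HC; split.
- intros cart; split; [apply pt_map_epi|].
  destruct (finitely_complete_pullback (pt_epi B) (pt_map_base h) HC)
    as (P & p & q & sq & univ).
  destruct (univ (pt_base A) (pt_sec B ∘ pt_map_base h) (id _))
    as (s & [ps qs] & _).
  { now rewrite comp_assoc, pt_split, comp_id_l, comp_id_r. }
  assert (exists t : Hom P (pt_top A),
    pt_map_top h ∘ t = p /\ pt_epi A ∘ t = q /\ t ∘ s = pt_sec A)
    as (t & pt & qt & ts).
  { pose (Q := {| pt_base := pt_base A;
                  pt_over := {| pt_epi := q; pt_sec := s; pt_split := qs |} |}).
    pose (k := @Build_PtHom C Q B (pt_map_base h) p sq ps).
    destruct (cart Q k (id _)) as ([b t et st] & [ht bt] & _).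
    { apply comp_id_r. }
    apply (f_equal (fun m : PtHom Q B => pt_map_top m)) in ht.
    simpl in ht, bt, et, st; subst b.
    rewrite comp_id_l in et; rewrite comp_id_r in st; eauto. }
  intros W a b e.
  destruct (univ W a b e) as (r & [pr qr] & ru).
  exists (t ∘ r); split.
  { rewrite !comp_assoc, pt, qt; auto. }
  (* the comparison [pt_top A -> P] is inverse to [t] *)
  destruct (univ (pt_top A) (pt_map_top h) (pt_epi A)) as (c & [pc qc] & cu).
  { apply pt_map_epi. }
  assert (cs : c ∘ pt_sec A = s).
  { destruct (univ (pt_base A) (pt_sec B ∘ pt_map_base h) (id _))
      as (s' & _ & s'u).
    { now rewrite comp_assoc, pt_split, comp_id_l, comp_id_r. }
    transitivity s'; [symmetry|]; apply s'u; split; auto;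
      rewrite comp_assoc, ?pc, ?qc; auto using pt_map_sec, pt_split. }
  assert (tc : t ∘ c = id _).
  { destruct (cart A h (id _)) as (j & _ & ju).
    { apply comp_id_r. }
    unshelve epose (t1 := @Build_PtHom C A A (id _) (t ∘ c) _ _).
    { now rewrite comp_assoc, qt, qc, comp_id_l. }
    { now rewrite <- comp_assoc, cs, ts, comp_id_r. }
    assert (e1 : j = t1).
    { apply ju; split; [apply pt_hom_ext; simpl|reflexivity].
      - apply comp_id_r.
      - now rewrite comp_assoc, pt. }
    assert (e2 : j = id A).
    { apply ju; split; [apply comp_id_r|reflexivity]. }
    rewrite e2 in e1.
    exact (eq_sym (f_equal (fun m : PtHom A A => pt_map_top m) e1)). }
  intros r' [e1 e2].
  rewrite (ru (c ∘ r')), comp_assoc, tc, comp_id_l; [reflexivity|].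
  rewrite !comp_assoc, pc, qc; auto.
- intros [sq univ] Z k g e; simpl in g, e.
  destruct (univ (pt_top Z) (pt_map_top k) (g ∘ pt_epi Z)) as (t & [ht et] & tu).
  { now rewrite pt_map_epi, comp_assoc, e. }
  unshelve epose (m := @Build_PtHom C Z A g t et _).
  { destruct (univ (pt_base Z) (pt_map_top k ∘ pt_sec Z) g) as (s & _ & su).
    { now rewrite comp_assoc, pt_map_epi, <- comp_assoc, pt_split, comp_id_r. }
    transitivity s; [symmetry|]; apply su; split.
    - now rewrite comp_assoc, ht.
    - now rewrite comp_assoc, et, <- comp_assoc, pt_split, comp_id_r.
    - now rewrite comp_assoc, pt_map_sec, <- comp_assoc, e, pt_map_sec.
    - now rewrite comp_assoc, pt_split, comp_id_l. }
  exists m; split.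
  { split; [apply pt_hom_ext; [exact e | exact ht] | reflexivity]. }
  intros m' [e1 e2]; apply pt_hom_ext; [symmetry; exact e2|].
  apply tu; split.
  + exact (f_equal (fun n : PtHom Z B => pt_map_top n) e1).
  + rewrite pt_map_epi; now rewrite <- e2.
Qed.

Definition P_decomposable (C : Category) : Prop :=
  finitely_complete C /\ has_extremal_decompositions (cartesian (Pt_functor C)).

Definition stably_P_decomposable (C : Category) : Prop :=
  finitely_complete C /\
  stably_has_extremal_decompositions (cartesian (Pt_functor C)).

Definition in_Pt (C : Category) (Y : C) (A : PointOver Y) : Pt C :=
  {| pt_base := Y; pt_over := A |}.

Record FibreHom (C : Category) (Y : C) (A B : PointOver Y) := {
  fibre_map : Hom (in_Pt A) (in_Pt B);
  fibre_map_base : pt_map_base fibre_map = id Y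
}.

Lemma fibre_hom_ext (C : Category) (Y : C) (A B : PointOver Y) (g h : FibreHom A B) :
  fibre_map g = fibre_map h -> g = h.
Proof.
destruct g as [g pg], h as [h ph]; simpl; intros <-.
f_equal; apply proof_irrelevance.
Qed.

Definition fibre_id (C : Category) (Y : C) (A : PointOver Y) : FibreHom A A :=
  {| fibre_map := id (in_Pt A); fibre_map_base := eq_refl |}.

Definition fibre_comp (C : Category) (Y : C) (A B D : PointOver Y)
    (g : FibreHom B D) (f : FibreHom A B) : FibreHom A D.
Proof.
refine {| fibre_map := fibre_map g ∘ fibre_map f |}.
abstract (simpl; rewrite !fibre_map_base; apply comp_id_l).
Defined.

Definition PtFibre (C : Category) (Y : C) : Category.
Proof.
refine {| Ob := PointOver Y; Hom := @FibreHom C Y;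
          id := @fibre_id C Y; comp := @fibre_comp C Y |};
abstract (intros; apply fibre_hom_ext;
          first [apply (@comp_id_l (Pt C)) | apply (@comp_id_r (Pt C))
                | apply (@comp_assoc (Pt C))]).
Defined.

Definition slice_one (E : Category) (Y : E) : Slice Y :=
  {| slice_dom := Y; slice_arr := id Y |}.

Definition fibre_to_coslice_ob (E : Category) (Y : E) (A : PointOver Y) :
    Coslice (slice_one Y) :=
  @Build_CosliceOb (Slice Y) (slice_one Y)
    (Build_SliceOb (pt_epi A))
    (@Build_SliceHom E Y (slice_one Y) (Build_SliceOb (pt_epi A))
       (pt_sec A) (pt_split A)).

Definition fibre_to_coslice_map (E : Category) (Y : E) (A B : PointOver Y)
    (h : FibreHom A B) :
  Hom (fibre_to_coslice_ob A) (fibre_to_coslice_ob B).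
Proof.
unshelve refine (@Build_CosliceHom (Slice Y) (slice_one Y)
  (fibre_to_coslice_ob A) (fibre_to_coslice_ob B)
  (@Build_SliceHom E Y (Build_SliceOb (pt_epi A)) (Build_SliceOb (pt_epi B))
     (pt_map_top (fibre_map h)) _) _).
- abstract (destruct h as [[y x ex sx] hy]; simpl in *; subst y;
            now rewrite ex, comp_id_l).
- abstract (apply slice_hom_ext; destruct h as [[y x ex sx] hy];
            simpl in *; subst y; now rewrite sx, comp_id_r).
Defined.

Definition fibre_to_coslice (E : Category) (Y : E) :
  Functor (PtFibre Y) (Coslice (slice_one Y)).
Proof.
refine {| fobj := (@fibre_to_coslice_ob E Y : PtFibre Y -> Coslice (slice_one Y));
          fmap := @fibre_to_coslice_map E Y |};
abstract (intros; apply coslice_hom_ext, slice_hom_ext; reflexivity).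
Defined.

(* Main.v *)
Require Import Defs.
From Stdlib Require Import List ProofIrrelevance ClassicalEpsilon.

(** The slice, the coslice and the fibre of points all come with a forgetful
    functor [G] that shares one property, called [lifts_decompositions] below.
    It is faithful and preserves pullbacks; a factorisation of [G v] through an
    object [X] is the image of a factorisation of [v], because the missing
    structure on [X] is transported along one of the two factors (a map to [Y]
    is precomposed with [X → T], a map from [Y] is postcomposed with [U → X]);
    and a map between images that is compatible with such factorisations is
    itself an image, since its compatibility with the added structure can be
    tested on the outer factors.

    The diagrams in the definition of an extremal decomposition are made of such
    factorisations and of a comparison map [t] between them, so a functor of
    this kind preserves and reflects extremal decompositions, whatever the class
    of maps is, as long as the class is itself preserved and reflected
    ([extremal_decomposition_iff]). Preservation of pullbacks, and hence of
    monomorphisms, is what is left to see that decompositions, and their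
    stability, pass from the target of the functor to its source.

    It remains to go from [G : C → E] to the induced functor
    [Pt G : Pt C → Pt E]. All the parts of [lifts_decompositions] are inherited
    levelwise ([lifts_decompositions_Pt]), pullbacks of points being computed
    levelwise. Cartesian maps of points are pullback squares, which [G]
    preserves by assumption and reflects because it reflects isomorphisms
    ([reflects_pullback]).

    Finite limits of a slice are limits in [E] of the diagram enlarged with [Y]
    as a terminal vertex; those of a coslice are computed in [E]. The fibre of
    points is isomorphic to the coslice of a slice, and an isomorphism of
    categories is a particular case of the functors above. *)

Set Implicit Arguments.
Unset Strict Implicit.

(** * Pullbacks and monomorphisms *)

Definition has_pullbacks (C : Category) : Prop :=
  forall (A B Z : C) (f : Hom A Z) (g : Hom B Z),
    exists (P : C) (p : Hom P A) (q : Hom P B), is_pullback f g p q.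

Lemma finitely_complete_has_pullbacks (C : Category) :
  finitely_complete C -> has_pullbacks C.
Proof. intros HC A B Z f g; now apply finitely_complete_pullback. Qed.

Lemma pullback_jointly_monic (C : Category) (P A B Z : C)
    (f : Hom A Z) (g : Hom B Z) (p : Hom P A) (q : Hom P B)
    (W : C) (s t : Hom W P) :
  is_pullback f g p q -> p ∘ s = p ∘ t -> q ∘ s = q ∘ t -> s = t.
Proof.
intros [sq univ] ep eq.
destruct (univ W (p ∘ t) (q ∘ t)) as (r & _ & ru).
{ now rewrite !comp_assoc, sq. }
transitivity r; [symmetry|]; apply ru; auto.
Qed.

Lemma is_pullback_iso (C : Category) (P P' A B Z : C)
    (f : Hom A Z) (g : Hom B Z) (p : Hom P A) (q : Hom P B)
    (c : Hom P' P) (d : Hom P P') :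
  is_pullback f g p q -> c ∘ d = id P -> d ∘ c = id P' ->
  is_pullback f g (p ∘ c) (q ∘ c).
Proof.
intros [sq univ] cd dc; split.
{ now rewrite !comp_assoc, sq. }
intros W a b e; destruct (univ W a b e) as (t & [pt qt] & tu).
exists (d ∘ t); split.
- now rewrite <- !(comp_assoc _ c), (comp_assoc c), cd, comp_id_l.
- intros t' [e1 e2]; rewrite (tu (c ∘ t')).
  + now rewrite comp_assoc, dc, comp_id_l.
  + now rewrite !comp_assoc.
Qed.

Lemma pullback_unique (C : Category) (P P' A B Z : C)
    (f : Hom A Z) (g : Hom B Z) (p : Hom P A) (q : Hom P B)
    (p' : Hom P' A) (q' : Hom P' B) :
  is_pullback f g p q -> is_pullback f g p' q' ->
  exists (c : Hom P' P) (d : Hom P P'),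
    c ∘ d = id P /\ d ∘ c = id P' /\ p ∘ c = p' /\ q ∘ c = q'.
Proof.
intros pb pb'.
destruct (proj2 pb P' p' q' (proj1 pb')) as (c & [pc qc] & _).
destruct (proj2 pb' P p q (proj1 pb)) as (d & [pd qd] & _).
exists c, d; repeat split; auto.
- apply (pullback_jointly_monic pb);
    rewrite comp_assoc, comp_id_r; now rewrite ?pc, ?qc.
- apply (pullback_jointly_monic pb');
    rewrite comp_assoc, comp_id_r; now rewrite ?pd, ?qd.
Qed.

Lemma mono_iff_pullback (C : Category) (A B : C) (m : Hom A B) :
  mono m <-> is_pullback m m (id A) (id A).
Proof.
split.
- intros hm; split; [reflexivity|].
  intros W a b e; apply hm in e; subst b.
  exists a; split; [split; apply comp_id_l|].
  intros t [et _]; now rewrite comp_id_l in et.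
- intros [_ univ] Z g h e.
  destruct (univ Z g h e) as (t & [eg eh] & _).
  now rewrite <- eg, <- eh.
Qed.

Definition preserves_pullbacks (C E : Category) (G : Functor C E) : Prop :=
  forall (P A B Z : C) (f : Hom A Z) (g : Hom B Z) (p : Hom P A) (q : Hom P B),
    is_pullback f g p q ->
    is_pullback (fmap G f) (fmap G g) (fmap G p) (fmap G q).

(** By uniqueness of pullbacks, one preserved pullback of each cospan is enough. *)
Lemma preserves_pullbacks_of_one (C E : Category) (G : Functor C E) :
  (forall (A B Z : C) (f : Hom A Z) (g : Hom B Z),
    exists (P : C) (p : Hom P A) (q : Hom P B),
      is_pullback f g p q /\
      is_pullback (fmap G f) (fmap G g) (fmap G p) (fmap G q)) ->
  preserves_pullbacks G.
Proof.
intros H P A B Z f g p q pb.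
destruct (H A B Z f g) as (P0 & p0 & q0 & pb0 & Gpb0).
destruct (pullback_unique pb0 pb) as (c & d & cd & dc & <- & <-).
rewrite !fmap_comp; apply is_pullback_iso with (d := fmap G d); auto;
  now rewrite <- fmap_comp, ?cd, ?dc, fmap_id.
Qed.

Lemma preserves_mono (C E : Category) (G : Functor C E) (A B : C) (m : Hom A B) :
  preserves_pullbacks G -> mono m -> mono (fmap G m).
Proof.
intros HG hm; apply mono_iff_pullback; rewrite <- fmap_id.
now apply HG, mono_iff_pullback.
Qed.

(** * Functors that lift extremal decompositions *)

(** An inductive family rather than an equation, so that the middle object [X]
    is identified with the image of an object without any transport of maps. *)
Inductive lifted_factorisation (C E : Category) (G : Functor C E) (U T : C)
    (v : Hom U T) : forall X : E, Hom (G U) X -> Hom X (G T) -> Prop :=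
| lifted_factorisation_intro (X : C) (u : Hom U X) (w : Hom X T) :
    v = w ∘ u -> @lifted_factorisation C E G U T v (G X) (fmap G u) (fmap G w).

Arguments lifted_factorisation {C E} G {U T} v {X} _ _.

(** In [ld_sandwich] the maps [a] and [b] need not have anything to do with one
    factorisation: in [Pt C] the condition is applied to the two legs of a
    point, which go from one factorisation to another one. *)
Record lifts_decompositions (C E : Category) (G : Functor C E) : Prop := {
  ld_faithful : forall (A B : C) (g h : Hom A B), fmap G g = fmap G h -> g = h;
  ld_sandwich : forall (U A B T : C) (p : Hom U A) (q : Hom B T)
    (a : Hom U B) (b : Hom A T) (t : Hom (G A) (G B)),
    t ∘ fmap G p = fmap G a -> fmap G q ∘ t = fmap G b ->
    exists t' : Hom A B, fmap G t' = t;
  ld_factorisation : forall (U T : C) (v : Hom U T) (X : E)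
    (u : Hom (G U) X) (w : Hom X (G T)),
    fmap G v = w ∘ u -> lifted_factorisation G v u w;
  ld_pullbacks : preserves_pullbacks G
}.

(** The inverse of [fmap G c] is sandwiched between [c] and [c], so [G] reflects
    isomorphisms; the comparison with an actual pullback is thus invertible. *)
Lemma reflects_pullback (C E : Category) (G : Functor C E) (P A B Z : C)
    (f : Hom A Z) (g : Hom B Z) (p : Hom P A) (q : Hom P B) :
  has_pullbacks C -> lifts_decompositions G ->
  is_pullback (fmap G f) (fmap G g) (fmap G p) (fmap G q) ->
  is_pullback f g p q.
Proof.
intros HC HG Gpb.
assert (sq : f ∘ p = g ∘ q).
{ apply (ld_faithful HG); rewrite !fmap_comp; apply Gpb. }
destruct (HC A B Z f g) as (P0 & p0 & q0 & pb0).
destruct (proj2 pb0 P p q sq) as (c & [<- <-] & _).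
pose proof (ld_pullbacks HG pb0) as Gpb0.
destruct (pullback_unique Gpb0 Gpb) as (c' & d & cd & dc & pc & qc).
assert (ec : c' = fmap G c).
{ apply (pullback_jointly_monic Gpb0); now rewrite ?pc, ?qc, fmap_comp. }
subst c'.
destruct (ld_sandwich HG (p := c) (q := c) (a := id P) (b := id P0) (t := d))
  as (d' & <-).
{ now rewrite fmap_id. }
{ now rewrite fmap_id. }
apply is_pullback_iso with (d := d'); auto;
  apply (ld_faithful HG); now rewrite fmap_comp, fmap_id.
Qed.

(** Competing decompositions of [G v] are images of competing decompositions of
    [v], and the comparison maps are sandwiched between them. *)
Lemma extremal_decomposition_iff (C E : Category) (G : Functor C E)
    (Θ' : MorClass C) (Θ : MorClass E) :
  lifts_decompositions G ->
  (forall (A B : C) (h : Hom A B), Θ' A B h <-> Θ (G A) (G B) (fmap G h)) ->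
  forall (U X T : C) (v : Hom U T) (w : Hom X T) (u : Hom U X),
    extremal_decomposition Θ' v w u <->
    extremal_decomposition Θ (fmap G v) (fmap G w) (fmap G u).
Proof.
intros HG HΘ U X T v w u; split; intros (hu & ev & univ); split.
- now apply HΘ.
- split; [now rewrite ev, fmap_comp|].
  intros X' u' w' hu' ev'.
  destruct (ld_factorisation HG ev') as [X' u' w' ev''].
  destruct (univ X' u' w') as (t & [e1 e2] & tu); [now apply HΘ | exact ev'' |].
  exists (fmap G t); split; [now rewrite <- !fmap_comp, e1, e2|].
  intros s [s1 s2].
  destruct (ld_sandwich HG s2 s1) as (s' & <-).
  f_equal; apply tu; split; apply (ld_faithful HG); now rewrite fmap_comp.
- now apply HΘ.
- split; [apply (ld_faithful HG); now rewrite fmap_comp|].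
  intros X' u' w' hu' ev'.
  destruct (univ (G X') (fmap G u') (fmap G w')) as (t & [e1 e2] & tu).
  { now apply HΘ. }
  { now rewrite ev', fmap_comp. }
  destruct (ld_sandwich HG e2 e1) as (t' & <-).
  exists t'; split.
  { split; apply (ld_faithful HG); now rewrite fmap_comp. }
  intros s [s1 s2]; apply (ld_faithful HG), tu.
  now rewrite <- !fmap_comp, s1, s2.
Qed.

Lemma lift_has_extremal_decompositions (C E : Category) (G : Functor C E)
    (Θ' : MorClass C) (Θ : MorClass E) :
  lifts_decompositions G ->
  (forall (A B : C) (h : Hom A B), Θ' A B h <-> Θ (G A) (G B) (fmap G h)) ->
  has_extremal_decompositions Θ -> has_extremal_decompositions Θ'.
Proof.
intros HG HΘ H U T v hv.
destruct (H _ _ _ (preserves_mono (ld_pullbacks HG) hv)) as (X & w & u & ext).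
destruct (ld_factorisation HG (proj1 (proj2 ext))) as [X u w ev].
exists X, w, u; now apply (extremal_decomposition_iff HG HΘ).
Qed.

Lemma lift_extremal_decompositions_stable (C E : Category) (G : Functor C E)
    (Θ' : MorClass C) (Θ : MorClass E) :
  lifts_decompositions G ->
  (forall (A B : C) (h : Hom A B), Θ' A B h <-> Θ (G A) (G B) (fmap G h)) ->
  extremal_decompositions_stable Θ -> extremal_decompositions_stable Θ'.
Proof.
intros HG HΘ H U X T v w u hv ext U' X' T' θ θU θX v' w' u' hθ pbv pbw eu ev.
apply (extremal_decomposition_iff HG HΘ).
apply (H _ _ _ (fmap G v) (fmap G w) (fmap G u)
         (preserves_mono (ld_pullbacks HG) hv)
         (proj1 (extremal_decomposition_iff HG HΘ v w u) ext)
         _ _ _ (fmap G θ) (fmap G θU) (fmap G θX)).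
- now apply HΘ.
- now apply (ld_pullbacks HG).
- now apply (ld_pullbacks HG).
- now rewrite <- !fmap_comp, eu.
- now rewrite <- fmap_comp, ev.
Qed.

(** * The induced functor on points *)

Definition Pt_map_ob (C E : Category) (G : Functor C E) (A : PtOb C) : PtOb E.
Proof.
refine {| pt_base := G (pt_base A);
          pt_over := {| pt_epi := fmap G (pt_epi A);
                        pt_sec := fmap G (pt_sec A) |} |}.
abstract (now rewrite <- fmap_comp, pt_split, fmap_id).
Defined.

Definition Pt_map_hom (C E : Category) (G : Functor C E) (A B : PtOb C)
    (h : PtHom A B) : PtHom (Pt_map_ob G A) (Pt_map_ob G B).
Proof.
refine (@Build_PtHom E (Pt_map_ob G A) (Pt_map_ob G B)
          (fmap G (pt_map_base h)) (fmap G (pt_map_top h)) _ _).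
- abstract (simpl; now rewrite <- !fmap_comp, pt_map_epi).
- abstract (simpl; now rewrite <- !fmap_comp, pt_map_sec).
Defined.

Definition Pt_map (C E : Category) (G : Functor C E) : Functor (Pt C) (Pt E).
Proof.
refine {| fobj := (Pt_map_ob G : Pt C -> Pt E); fmap := @Pt_map_hom C E G |}.
- abstract (intros; apply pt_hom_ext; apply fmap_id).
- abstract (intros; apply pt_hom_ext; apply fmap_comp).
Defined.

Lemma pt_pullback_levelwise (C : Category) (P A B Z : Pt C)
    (f : Hom A Z) (g : Hom B Z) (p : Hom P A) (q : Hom P B) :
  is_pullback (pt_map_base f) (pt_map_base g) (pt_map_base p) (pt_map_base q) ->
  is_pullback (pt_map_top f) (pt_map_top g) (pt_map_top p) (pt_map_top q) ->
  is_pullback f g p q.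
Proof.
intros pb0 pb1; split; [apply pt_hom_ext; [apply pb0 | apply pb1]|].
intros W a b e.
destruct (proj2 pb0 _ (pt_map_base a) (pt_map_base b)) as (t0 & [p0 q0] & u0).
{ exact (f_equal (fun h : PtHom W Z => pt_map_base h) e). }
destruct (proj2 pb1 _ (pt_map_top a) (pt_map_top b)) as (t1 & [p1 q1] & u1).
{ exact (f_equal (fun h : PtHom W Z => pt_map_top h) e). }
unshelve epose (t := @Build_PtHom C W P t0 t1 _ _).
- apply (pullback_jointly_monic pb0);
    rewrite !comp_assoc, <- pt_map_epi, ?p0, ?q0, <- comp_assoc, ?p1, ?q1;
    apply pt_map_epi.
- apply (pullback_jointly_monic pb1);
    rewrite !comp_assoc, ?p1, ?q1, !pt_map_sec, <- comp_assoc, ?p0, ?q0;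
    reflexivity.
- exists t; split; [split; apply pt_hom_ext; assumption|].
  intros s [<- <-]; apply pt_hom_ext; simpl; auto.
Qed.

Lemma pt_has_levelwise_pullbacks (C : Category) (A B Z : Pt C)
    (f : Hom A Z) (g : Hom B Z) :
  has_pullbacks C ->
  exists (P : Pt C) (p : Hom P A) (q : Hom P B),
    is_pullback (pt_map_base f) (pt_map_base g) (pt_map_base p) (pt_map_base q) /\
    is_pullback (pt_map_top f) (pt_map_top g) (pt_map_top p) (pt_map_top q).
Proof.
intros HC.
destruct (HC _ _ _ (pt_map_base f) (pt_map_base g)) as (P0 & p0 & q0 & pb0).
destruct (HC _ _ _ (pt_map_top f) (pt_map_top g)) as (P1 & p1 & q1 & pb1).
destruct (proj2 pb0 P1 (pt_epi A ∘ p1) (pt_epi B ∘ q1)) as (e & [pe qe] & _).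
{ now rewrite !comp_assoc, <- !pt_map_epi, <- !comp_assoc, (proj1 pb1). }
destruct (proj2 pb1 P0 (pt_sec A ∘ p0) (pt_sec B ∘ q0)) as (s & [ps qs] & _).
{ now rewrite !comp_assoc, !pt_map_sec, <- !comp_assoc, (proj1 pb0). }
assert (es : e ∘ s = id P0).
{ apply (pullback_jointly_monic pb0);
    rewrite comp_assoc, comp_id_r, ?pe, ?qe, <- comp_assoc, ?ps, ?qs,
      comp_assoc, pt_split; apply comp_id_l. }
pose (P := {| pt_base := P0;
              pt_over := {| pt_epi := e; pt_sec := s; pt_split := es |} |}).
exists P, (@Build_PtHom C P A p0 p1 (eq_sym pe) ps),
  (@Build_PtHom C P B q0 q1 (eq_sym qe) qs); auto.
Qed.

Lemma Pt_map_factorisation (C E : Category) (G : Functor C E) :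
  lifts_decompositions G ->
  forall (U T : Pt C) (v : Hom U T) (X : Pt E)
    (u : Hom (Pt_map G U) X) (w : Hom X (Pt_map G T)),
    fmap (Pt_map G) v = w ∘ u -> lifted_factorisation (Pt_map G) v u w.
Proof.
intros HG U T v [X0 [X1 f s fs]] [u0 u1 uf us] [w0 w1 wf ws] e; simpl in *.
assert (e0 : fmap G (pt_map_base v) = w0 ∘ u0)
  by exact (f_equal (fun h : PtHom _ _ => pt_map_base h) e).
assert (e1 : fmap G (pt_map_top v) = w1 ∘ u1)
  by exact (f_equal (fun h : PtHom _ _ => pt_map_top h) e).
clear e.
revert f s fs uf us wf ws e1.
destruct (ld_factorisation HG e0) as [X0 u0 w0 e0']; clear e0.
intros f s fs uf us wf ws e1; revert f s fs uf us wf ws.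
destruct (ld_factorisation HG e1) as [X1 u1 w1 e1']; clear e1.
intros f s fs uf us wf ws.
destruct (ld_sandwich HG (p := u1) (q := w0) (a := u0 ∘ pt_epi U)
            (b := pt_epi T ∘ w1) (t := f)) as (f' & <-).
{ now rewrite fmap_comp. }
{ now rewrite fmap_comp. }
destruct (ld_sandwich HG (p := u0) (q := w1) (a := u1 ∘ pt_sec U)
            (b := pt_sec T ∘ w0) (t := s)) as (s' & <-).
{ now rewrite fmap_comp. }
{ now rewrite fmap_comp. }
assert (fs' : f' ∘ s' = id X0).
{ apply (ld_faithful HG); now rewrite fmap_comp, fmap_id. }
pose (X := {| pt_base := X0;
              pt_over := {| pt_epi := f'; pt_sec := s'; pt_split := fs' |} |}).
unshelve epose (u := @Build_PtHom C U X u0 u1 _ _).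
{ apply (ld_faithful HG); simpl; now rewrite !fmap_comp. }
{ apply (ld_faithful HG); simpl; now rewrite !fmap_comp. }
unshelve epose (w := @Build_PtHom C X T w0 w1 _ _).
{ apply (ld_faithful HG); simpl; now rewrite !fmap_comp. }
{ apply (ld_faithful HG); simpl; now rewrite !fmap_comp. }
(* what is left differs from the image of [X], [u], [w] by proofs of equations *)
rewrite (proof_irrelevance _ fs (pt_split (Pt_map_ob G X))) in *.
match goal with |- lifted_factorisation _ _ ?a ?b =>
  replace a with (fmap (Pt_map G) u) by (apply pt_hom_ext; reflexivity);
  replace b with (fmap (Pt_map G) w) by (apply pt_hom_ext; reflexivity)
end.
apply (@lifted_factorisation_intro (Pt C) (Pt E) (Pt_map G) U T v X u w).
apply pt_hom_ext; assumption.
Qed.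

Lemma lifts_decompositions_Pt (C E : Category) (G : Functor C E) :
  has_pullbacks C -> lifts_decompositions G -> lifts_decompositions (Pt_map G).
Proof.
intros HC HG; split.
- intros A B g h e; apply pt_hom_ext; apply (ld_faithful HG).
  + exact (f_equal (fun h : PtHom _ _ => pt_map_base h) e).
  + exact (f_equal (fun h : PtHom _ _ => pt_map_top h) e).
- intros U A B T p q a b [t0 t1 te ts] ea eb; simpl in *.
  destruct (ld_sandwich HG (p := pt_map_base p) (q := pt_map_base q)
    (a := pt_map_base a) (b := pt_map_base b) (t := t0)) as (t0' & <-).
  { exact (f_equal (fun h : PtHom _ _ => pt_map_base h) ea). }
  { exact (f_equal (fun h : PtHom _ _ => pt_map_base h) eb). }
  destruct (ld_sandwich HG (p := pt_map_top p) (q := pt_map_top q)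
    (a := pt_map_top a) (b := pt_map_top b) (t := t1)) as (t1' & <-).
  { exact (f_equal (fun h : PtHom _ _ => pt_map_top h) ea). }
  { exact (f_equal (fun h : PtHom _ _ => pt_map_top h) eb). }
  unshelve eexists (@Build_PtHom C A B t0' t1' _ _).
  + apply (ld_faithful HG); now rewrite !fmap_comp.
  + apply (ld_faithful HG); now rewrite !fmap_comp.
  + apply pt_hom_ext; reflexivity.
- now apply Pt_map_factorisation.
- (* the universal property in [Pt C] says nothing directly about tops, so a
     levelwise pullback is used for comparison *)
  apply preserves_pullbacks_of_one; intros A B Z f g.
  destruct (pt_has_levelwise_pullbacks f g HC) as (P & p & q & pb0 & pb1).
  exists P, p, q; split; apply pt_pullback_levelwise; auto;
    now apply (ld_pullbacks HG).
Qed.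

Lemma Pt_map_cartesian_iff (C E : Category) (G : Functor C E) :
  finitely_complete C -> finitely_complete E -> lifts_decompositions G ->
  forall (A B : Pt C) (h : Hom A B),
    cartesian (Pt_functor C) h <-> cartesian (Pt_functor E) (fmap (Pt_map G) h).
Proof.
intros HC HE HG A B h; rewrite !cartesian_iff_pullback by assumption; split.
- apply (ld_pullbacks HG).
- exact (reflects_pullback (finitely_complete_has_pullbacks HC) HG).
Qed.

Lemma lift_P_decomposable (C E : Category) (G : Functor C E) :
  finitely_complete C -> lifts_decompositions G ->
  P_decomposable E -> P_decomposable C.
Proof.
intros HC HG [HE H]; split; [assumption|].
apply (lift_has_extremal_decompositions
         (lifts_decompositions_Pt (finitely_complete_has_pullbacks HC) HG)
         (Pt_map_cartesian_iff HC HE HG) H).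
Qed.

Lemma lift_stably_P_decomposable (C E : Category) (G : Functor C E) :
  finitely_complete C -> lifts_decompositions G ->
  stably_P_decomposable E -> stably_P_decomposable C.
Proof.
intros HC HG [HE [H HS]]; split; [assumption|].
pose proof (lifts_decompositions_Pt (finitely_complete_has_pullbacks HC) HG) as HP.
pose proof (Pt_map_cartesian_iff HC HE HG) as Hcart; split.
- exact (lift_has_extremal_decompositions HP Hcart H).
- exact (lift_extremal_decompositions_stable HP Hcart HS).
Qed.

(** * Slices *)

Definition slice_forget (E : Category) (Y : E) : Functor (Slice Y) E.
Proof.
refine {| fobj := (@slice_dom E Y : Slice Y -> E); fmap := @slice_map E Y |};
abstract reflexivity.
Defined.

(** A map in [E] into the domain of a slice object inherits a map to [Y], so the
    universal property of a pullback in the slice already tests all of [E]. *)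
Lemma slice_lifts_decompositions (E : Category) (Y : E) :
  lifts_decompositions (slice_forget Y).
Proof.
split.
- intros A B g h; apply slice_hom_ext.
- intros U A B T p q a b t _ eb; simpl in *.
  unshelve eexists (@Build_SliceHom E Y A B t _); [|reflexivity].
  now rewrite <- (slice_map_arr q), <- comp_assoc, eb, slice_map_arr.
- intros U T v X u w e; simpl in *.
  pose (X' := {| slice_dom := X; slice_arr := slice_arr T ∘ w |}).
  assert (eu : slice_arr X' ∘ u = slice_arr U).
  { simpl; now rewrite <- comp_assoc, <- e, slice_map_arr. }
  apply (@lifted_factorisation_intro (Slice Y) E (slice_forget Y) U T v X'
    (@Build_SliceHom E Y U X' u eu) (@Build_SliceHom E Y X' T w eq_refl)).
  apply slice_hom_ext; exact e.
- intros P A B Z f g p q [sq univ]; split.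
  { exact (f_equal (fun h : SliceHom P Z => slice_map h) sq). }
  intros W a b e; simpl in *.
  pose (W' := {| slice_dom := W; slice_arr := slice_arr A ∘ a |}).
  assert (eb : slice_arr B ∘ b = slice_arr W').
  { simpl; now rewrite <- (slice_map_arr g), <- (slice_map_arr f),
      <- !comp_assoc, e. }
  pose (a' := @Build_SliceHom E Y W' A a eq_refl).
  pose (b' := @Build_SliceHom E Y W' B b eb).
  destruct (univ W' a' b') as (t & [et1 et2] & tu).
  { apply slice_hom_ext; exact e. }
  exists (slice_map t); split.
  { split; [exact (f_equal (fun h : SliceHom _ _ => slice_map h) et1)
           |exact (f_equal (fun h : SliceHom _ _ => slice_map h) et2)]. }
  intros s [s1 s2].
  assert (es : slice_arr P ∘ s = slice_arr W').
  { simpl; now rewrite <- (slice_map_arr p), <- comp_assoc, s1. }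
  rewrite (tu (@Build_SliceHom E Y W' P s es)); [reflexivity|].
  split; apply slice_hom_ext; assumption.
Qed.

Definition add_terminal_hom (J : Category) (i j : option J) : Type :=
  match i, j with
  | _, None => unit
  | Some i', Some j' => Hom i' j'
  | None, Some _ => Empty_set
  end.

Definition add_terminal (J : Category) : Category.
Proof.
unshelve refine {| Ob := option J; Hom := @add_terminal_hom J |}.
- intros [i|]; [exact (id i) | exact tt].
- intros [i|] [j|] [k|] g f; try exact tt; try destruct f; try destruct g.
  exact (comp g f).
- abstract (intros [i|] [j|] f; simpl; try destruct f; auto using comp_id_l).
- abstract (intros [i|] [j|] f; simpl; try destruct f; auto using comp_id_r).
- abstract (intros [i|] [j|] [k|] [l|] h g f; simpl;
            try destruct f; try destruct g; try destruct h;
            auto using comp_assoc).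
Defined.

Lemma finite_add_terminal (J : Category) :
  finite_category J -> finite_category (add_terminal J).
Proof.
intros [[l Hl] HJ]; split.
- exists (None :: map Some l); intros [j|]; simpl; auto using in_map.
- intros [i|] [j|]; simpl.
  + apply HJ.
  + exists (tt :: nil); intros []; simpl; auto.
  + exists nil; intros [].
  + exists (tt :: nil); intros []; simpl; auto.
Qed.

Definition slice_diagram (J E : Category) (Y : E) (D : Functor J (Slice Y)) :
  Functor (add_terminal J) E.
Proof.
unshelve refine {|
  fobj := (fun i : add_terminal J =>
    match i with Some j => slice_dom (D j) | None => Y end) |}.
- intros [i|] [j|] h.
  + exact (slice_map (fmap D h)).
  + exact (slice_arr (D i)).
  + destruct h.
  + exact (id Y).
- abstract (intros [i|]; simpl; [now rewrite fmap_id | reflexivity]).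
- abstract (intros [i|] [j|] [k|] g f; simpl in *;
            try destruct f; try destruct g;
            first [now rewrite fmap_comp | now rewrite slice_map_arr
                  | now rewrite comp_id_l]).
Defined.

(** The leg at the added vertex is the structure map of the limit. *)
Lemma slice_finitely_complete (E : Category) (Y : E) :
  finitely_complete E -> finitely_complete (Slice Y).
Proof.
intros HE J HJ D.
destruct (HE _ (finite_add_terminal HJ) (slice_diagram D)) as (L & p & cone & univ).
pose (L' := {| slice_dom := L; slice_arr := p None |}).
assert (Hp : forall j, slice_arr (D j) ∘ p (Some j) = slice_arr L').
{ intros j; exact (cone (Some j) None tt). }
exists L', (fun j => @Build_SliceHom E Y L' (D j) (p (Some j)) (Hp j)); split.
{ intros i j h; apply slice_hom_ext; exact (cone (Some i) (Some j) h). }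
intros Z q Hq.
destruct (univ (slice_dom Z) (fun i : option J =>
  match i return Hom (slice_dom Z) (slice_diagram D i) with
  | Some j => slice_map (q j) | None => slice_arr Z end)) as (t & ht & tu).
{ intros [i|] [j|] h; simpl; try destruct h.
  - exact (f_equal (fun g : SliceHom _ _ => slice_map g) (Hq i j h)).
  - apply slice_map_arr.
  - apply comp_id_l. }
exists (@Build_SliceHom E Y Z L' t (ht None)); split.
{ intros j; apply slice_hom_ext; exact (ht (Some j)). }
intros s hs; apply slice_hom_ext; apply tu; intros [j|].
- exact (f_equal (fun g : SliceHom _ _ => slice_map g) (hs j)).
- exact (slice_map_arr s).
Qed.

(** * Coslices *)

Definition coslice_forget (E : Category) (Y : E) : Functor (Coslice Y) E.
Proof.
refine {| fobj := (@coslice_cod E Y : Coslice Y -> E); fmap := @coslice_map E Y |};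
abstract reflexivity.
Defined.

(** Pullbacks of [E] are needed here: an object of [E] mapping into a coslice
    object carries no map from [Y], so that the pullbacks of the coslice have to
    be compared with those of [E]. *)
Lemma coslice_lifts_decompositions (E : Category) (Y : E) :
  has_pullbacks E -> lifts_decompositions (coslice_forget Y).
Proof.
intros HE; split.
- intros A B g h; apply coslice_hom_ext.
- intros U A B T p q a b t ea _; simpl in *.
  unshelve eexists (@Build_CosliceHom E Y A B t _); [|reflexivity].
  now rewrite <- (coslice_map_arr p), comp_assoc, ea, coslice_map_arr.
- intros U T v X u w e; simpl in *.
  pose (X' := {| coslice_cod := X; coslice_arr := u ∘ coslice_arr U |}).
  assert (ew : w ∘ coslice_arr X' = coslice_arr T).
  { simpl; now rewrite comp_assoc, <- e, coslice_map_arr. }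
  apply (@lifted_factorisation_intro (Coslice Y) E (coslice_forget Y) U T v X'
    (@Build_CosliceHom E Y U X' u eq_refl) (@Build_CosliceHom E Y X' T w ew)).
  apply coslice_hom_ext; exact e.
- apply preserves_pullbacks_of_one; intros A B Z f g.
  destruct (HE _ _ _ (coslice_map f) (coslice_map g)) as (P & p & q & pb).
  destruct (proj2 pb Y (coslice_arr A) (coslice_arr B)) as (y & [py qy] & _).
  { now rewrite !coslice_map_arr. }
  pose (P' := {| coslice_cod := P; coslice_arr := y |}).
  exists P', (@Build_CosliceHom E Y P' A p py), (@Build_CosliceHom E Y P' B q qy).
  split; [|exact pb].
  split; [apply coslice_hom_ext; apply pb|].
  intros W a b e.
  destruct (proj2 pb _ (coslice_map a) (coslice_map b)) as (t & [pt qt] & tu).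
  { exact (f_equal (fun h : CosliceHom _ _ => coslice_map h) e). }
  assert (et : t ∘ coslice_arr W = y).
  { apply (pullback_jointly_monic pb);
      rewrite comp_assoc, ?pt, ?qt, coslice_map_arr; auto. }
  exists (@Build_CosliceHom E Y W P' t et); split.
  { split; apply coslice_hom_ext; assumption. }
  intros s [<- <-]; apply coslice_hom_ext; apply tu; auto.
Qed.

Lemma coslice_finitely_complete (E : Category) (Y : E) :
  finitely_complete E -> finitely_complete (Coslice Y).
Proof.
intros HE J HJ D.
unshelve epose (D' := {| fobj := (fun j : J => coslice_cod (D j));
  fmap := (fun i j (h : Hom i j) => coslice_map (fmap D h)) |}).
{ intros; simpl; now rewrite fmap_id. }
{ intros; simpl; now rewrite fmap_comp. }
destruct (HE J HJ D') as (L & p & cone & univ).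
destruct (univ Y (fun j => coslice_arr (D j))) as (y & hy & yu).
{ intros i j h; apply coslice_map_arr. }
pose (L' := {| coslice_cod := L; coslice_arr := y |}).
exists L', (fun j => @Build_CosliceHom E Y L' (D j) (p j) (hy j)); split.
{ intros i j h; apply coslice_hom_ext; exact (cone i j h). }
intros Z q Hq.
destruct (univ (coslice_cod Z) (fun j => coslice_map (q j))) as (t & ht & tu).
{ intros i j h; exact (f_equal (fun g : CosliceHom _ _ => coslice_map g) (Hq i j h)). }
assert (et : t ∘ coslice_arr Z = coslice_arr L').
{ symmetry; apply yu; intros j.
  rewrite comp_assoc, ht; apply coslice_map_arr. }
exists (@Build_CosliceHom E Y Z L' t et); split.
{ intros j; apply coslice_hom_ext; apply ht. }
intros s hs; apply coslice_hom_ext; apply tu; intros j.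
exact (f_equal (fun g : CosliceHom _ _ => coslice_map g) (hs j)).
Qed.

(** * Isomorphisms of categories *)

Lemma iso_faithful (C E : Category) (F : Functor C E) :
  is_isomorphism_of_categories F ->
  forall (A B : C) (g h : Hom A B), fmap F g = fmap F h -> g = h.
Proof.
intros [_ H] A B g h e; destruct (H A B (fmap F g)) as (k & _ & ku).
transitivity k; [symmetry|]; apply ku; auto.
Qed.

Lemma iso_full (C E : Category) (F : Functor C E) :
  is_isomorphism_of_categories F ->
  forall (A B : C) (t : Hom (F A) (F B)), exists t' : Hom A B, fmap F t' = t.
Proof.
intros [_ H] A B t; destruct (H A B t) as (k & e & _); now exists k.
Qed.

Lemma iso_lifts_decompositions (C E : Category) (F : Functor C E) :
  is_isomorphism_of_categories F -> lifts_decompositions F.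
Proof.
intros HF; split.
- now apply iso_faithful.
- intros; now apply iso_full.
- intros U T v X u w e.
  destruct (proj1 HF X) as (X' & <- & _).
  destruct (iso_full HF u) as (u' & <-).
  destruct (iso_full HF w) as (w' & <-).
  constructor; apply (iso_faithful HF); now rewrite fmap_comp.
- intros P A B Z f g p q [sq univ]; split.
  { now rewrite <- !fmap_comp, sq. }
  intros W a b e.
  destruct (proj1 HF W) as (W' & <- & _).
  destruct (iso_full HF a) as (a' & <-).
  destruct (iso_full HF b) as (b' & <-).
  destruct (univ W' a' b') as (t & [<- <-] & tu).
  { apply (iso_faithful HF); now rewrite !fmap_comp. }
  exists (fmap F t); split; [now rewrite !fmap_comp|].
  intros s [s1 s2]; destruct (iso_full HF s) as (s' & <-).
  f_equal; apply tu; split; apply (iso_faithful HF); now rewrite fmap_comp.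
Qed.

(** Fullness gives the legs of the lifted limit one at a time, and choice makes
    them into a family. *)
Lemma iso_finitely_complete (C E : Category) (F : Functor C E) :
  is_isomorphism_of_categories F -> finitely_complete E -> finitely_complete C.
Proof.
intros HF HE J HJ D.
unshelve epose (D' := {| fobj := (fun j : J => F (D j));
  fmap := (fun i j (h : Hom i j) => fmap F (fmap D h)) |}).
{ intros; simpl; now rewrite !fmap_id. }
{ intros; simpl; now rewrite !fmap_comp. }
destruct (HE J HJ D') as (L & p & cone & univ).
destruct (proj1 HF L) as (L' & <- & _).
pose (p' := fun j =>
  proj1_sig (constructive_indefinite_description _ (iso_full HF (p j)))).
assert (Hp : forall j, fmap F (p' j) = p j).
{ intros j; exact (proj2_sig
    (constructive_indefinite_description _ (iso_full HF (p j)))). }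
exists L', p'; split.
{ intros i j h; apply (iso_faithful HF); rewrite fmap_comp, !Hp.
  exact (cone i j h). }
intros Z q Hq.
destruct (univ (F Z) (fun j => fmap F (q j))) as (t & ht & tu).
{ intros i j h; simpl; now rewrite <- fmap_comp, Hq. }
destruct (iso_full HF t) as (t' & <-).
exists t'; split.
{ intros j; apply (iso_faithful HF); rewrite fmap_comp, Hp; apply ht. }
intros s hs; apply (iso_faithful HF), tu; intros j.
rewrite <- Hp, <- (hs j); symmetry; exact (fmap_comp F (p' j) s).
Qed.

Definition coslice_to_fibre_ob (E : Category) (Y : E)
    (B : CosliceOb (slice_one Y)) : PointOver Y :=
  {| pt_epi := slice_arr (coslice_cod B);
     pt_sec := slice_map (coslice_arr B);
     pt_split := slice_map_arr (coslice_arr B) |}.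

Lemma fibre_to_coslice_iso (E : Category) (Y : E) :
  is_isomorphism_of_categories (fibre_to_coslice Y).
Proof.
split.
- intros B; exists (coslice_to_fibre_ob B); split.
  + now destruct B as [[X f] [s fs]].
  + intros A <-; now destruct A.
- intros A B [[t te] ts]; simpl in *.
  unshelve epose (h := @Build_FibreHom E Y A B
    (@Build_PtHom E (in_Pt A) (in_Pt B) (id Y) t _ _) eq_refl).
  + simpl; now rewrite comp_id_l.
  + simpl; rewrite comp_id_r.
    exact (f_equal (fun g : SliceHom _ _ => slice_map g) ts).
  + exists h; split.
    { apply coslice_hom_ext, slice_hom_ext; reflexivity. }
    intros k e; apply fibre_hom_ext, pt_hom_ext; simpl.
    * symmetry; exact (fibre_map_base k).
    * symmetry.
      pose proof (f_equal (fun g : CosliceHom _ _ => coslice_map g) e) as e'.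
      exact (f_equal (fun g : SliceHom _ _ => slice_map g) e').
Qed.

Unset Implicit Arguments.
Set Strict Implicit.

Theorem corollary5p1 (E : Category) (HE : finitely_complete E) (Y : E) :
  (P_decomposable E ->
     P_decomposable (Slice Y) /\ P_decomposable (Coslice Y) /\
     P_decomposable (PtFibre Y)) /\
  (stably_P_decomposable E ->
     stably_P_decomposable (Slice Y) /\ stably_P_decomposable (Coslice Y) /\
     stably_P_decomposable (PtFibre Y)) /\
  is_isomorphism_of_categories (fibre_to_coslice Y).
Proof.
pose proof (fibre_to_coslice_iso Y) as Hiso.
pose proof (@slice_finitely_complete E Y HE) as HS.
pose proof (@coslice_finitely_complete E Y HE) as HK.
pose proof (@coslice_finitely_complete (Slice Y) (slice_one Y) HS) as HSK.
pose proof (iso_finitely_complete Hiso HSK) as HF.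
pose proof (slice_lifts_decompositions Y) as GS.
pose proof (@coslice_lifts_decompositions E Y
              (finitely_complete_has_pullbacks HE)) as GK.
pose proof (@coslice_lifts_decompositions (Slice Y) (slice_one Y)
              (finitely_complete_has_pullbacks HS)) as GSK.
pose proof (iso_lifts_decompositions Hiso) as GF.
split; [|split]; [intros H|intros H|exact Hiso].
- pose proof (lift_P_decomposable HS GS H) as H'.
  split; [exact H' | split; [exact (lift_P_decomposable HK GK H)|]].
  exact (lift_P_decomposable HF GF (lift_P_decomposable HSK GSK H')).
- pose proof (lift_stably_P_decomposable HS GS H) as H'.
  split; [exact H' | split; [exact (lift_stably_P_decomposable HK GK H)|]].
  exact (lift_stably_P_decomposable HF GF (lift_stably_P_decomposable HSK GSK H')).
Qed.
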